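(* For any integer $k \geq 3$ there exists a finite algebraic extension $K$ of $\mathbb{Q}$ such that $Q_{\mathbb{C}}(k) = Q_K(k)$, where the degree $[K:\mathbb{Q}]$ is at most $k^{2^k}$ if $k$ is even, and at most $(k+1)^{2^k}$ if $k$ is odd.
   Context: For a field $K$ of characteristic zero and $f\in K[x]$, $N(f)$ denotes the number of non-zero terms (monomials with non-zero coefficient) of $f$. For $k\geq 1$, $Q_K(k) = \min\{N(f^2) : f \in K[x],\ N(f) = k\}$. *)

(* Defs.v *)
From mathcomp Require Import all_boot all_order all_algebra all_field.
From mathcomp Require Import boolp reals complex.

Set Implicit Arguments.
Unset Strict Implicit.
Unset Printing Implicit Defensive.

Import GRing.Theory.

Local Open Scope ring_scope.

Definition nterms (K : fieldType) (f : {poly K}) : nat :=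
  count (fun c => c != 0) f.

Definition sqr_nterms (K : fieldType) (k : nat) : pred nat :=
  fun n => `[< exists f : {poly K}, nterms f = k /\ nterms (f ^+ 2) = n >].

Lemma sqr_nterms_neq0 (K : fieldType) (k : nat) : exists n, sqr_nterms K k n.
Proof.
pose f : {poly K} := \poly_(i < k) 1.
exists (nterms (f ^+ 2)); apply/asboolP; exists f; split => //.
case: k @f => [|k] f; first by rewrite /nterms /f poly_def big_ord0 polyseq0.
have sz : size f = k.+1 by rewrite size_poly_eq // oner_neq0.
rewrite /nterms -[RHS]sz; apply/eqP; rewrite -all_count.
apply/(all_nthP 0) => i; rewrite sz => lt_ik.
by rewrite coef_poly lt_ik oner_neq0.
Qed.

Definition Qmin (K : fieldType) (k : nat) : nat :=
  ex_minn (sqr_nterms_neq0 K k).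

(* Main.v *)
(** An optimal [f] over the complex numbers, with its support fixed, is a point
    [a] on a system of integer quadrics with all coordinates non-zero.  Rescaling
    [f] to [c f(t X)] fixes two coefficients to 1, and an extra coordinate, the
    inverse of the product of the others, encodes their non-vanishing; this leaves
    [k - 1] coordinates and equations of degree at most [k - 1].  It then suffices
    that every point [a] of an [n]-dimensional space has a "specialization" [b]
    over a number field of bounded degree, where every integer polynomial of
    degree at most [d] that vanishes at [a] vanishes at [b].  This is Kronecker's
    elimination: take a polynomial [f] of least degree vanishing at [a], shear the
    coordinates so that it has a constant leading coefficient in the last one, and
    specialize the other coordinates with respect to degree [2 d ^ 2], the degree
    of the resultants of [f].  As a rational vector space of polynomials, each of
    which vanishes at one of the finitely many roots of [f], vanishes altogether at
    one of them, that root is the last coordinate of [b].  The degrees obtained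
    this way are at most [(2 d) ^ (2 ^ n)]. *)

Require Import Defs.
From mathcomp Require Import all_boot all_order all_algebra all_field.
From mathcomp Require Import perm boolp reals complex.

Set Implicit Arguments.
Unset Strict Implicit.
Unset Printing Implicit Defensive.

Import Order.TTheory GRing.Theory Num.Theory.

Local Open Scope ring_scope.

(** * Adjoining a root to a number field embedded in [L] *)

Lemma dim_baseFieldType (F0 : fieldType) (F : fieldExtType F0)
    (L : fieldExtType F) :
  \dim {:baseFieldType L} = (\dim {:L} * \dim {:F})%N.
Proof.
rewrite -dim_baseVspace; congr (\dim _).
apply/vspaceP => x; rewrite mem_baseVspace memvf.
by symmetry; exact: (@memvf F L).
Qed.

(** Among the nonzero polynomials over [K] with root [z], one of least size is irreducible, and the
    field it defines has degree over [K] at most that of [p]. *)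
Lemma adjoin_root (L : fieldType) (K : fieldExtType rat)
    (iota : {rmorphism K -> L}) (p : {poly K}) (z : L) :
  p != 0 -> root (map_poly iota p) z ->
  exists (E : fieldExtType rat) (iotaE : {rmorphism E -> L})
         (j : K -> E) (w : E),
    [/\ forall x, iotaE (j x) = iota x, iotaE w = z
      & (\dim {:E} <= (size p).-1 * \dim {:K})%N].
Proof.
move=> nz_p pz0.
pose P m := `[< exists q : {poly K},
                  [/\ q != 0, root (map_poly iota q) z & size q = m] >].
have exP : exists m, P m by exists (size p); apply/asboolP; exists p.
case: (ex_minnP exP) => m /asboolP[q [nz_q qz0 <-{m}]] q_min.
have irr_q : irreducible_poly q.
  apply/(subfx_irreducibleP qz0 nz_q) => r rz0 nz_r.
  by apply: q_min; apply/asboolP; exists r.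
pose E := SubFieldExtType qz0 irr_q.
exists (baseFieldType E), (subfx_inj : {rmorphism E -> L}), (in_alg E).
exists (subfx_root iota z q : E).
split; [exact: subfx_inj_base | exact: subfx_inj_root |].
have dimE : \dim {:E} = (size q).-1 by rewrite dimvf.
rewrite dim_baseFieldType dimE leq_mul2r -!subn1 leq_sub2r ?orbT // q_min //.
by apply/asboolP; exists p.
Qed.

(** * Integer polynomials of bounded degree, as functions *)

Inductive polfun (C : numClosedFieldType) (n : nat) :
    nat -> ((nat -> C) -> C) -> Prop :=
| PolC d (m : int) : polfun n d (fun=> m%:~R)
| PolX d i f : (i < n)%N -> polfun n d f -> polfun n d.+1 (fun x => x i * f x)
| PolD d f g : polfun n d f -> polfun n d g -> polfun n d (fun x => f x + g x).

Lemma polfun_eq (C : numClosedFieldType) n d (f g : (nat -> C) -> C) :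
  f =1 g -> polfun n d f -> polfun n d g.
Proof. by move=> /funext ->. Qed.

Lemma polfunW (C : numClosedFieldType) n d e (f : (nat -> C) -> C) :
  (d <= e)%N -> polfun n d f -> polfun n e f.
Proof.
move=> le_de f_pol.
elim: f_pol e le_de => {d f} [d m|d i f lt_in _ IH|d f g _ IHf _ IHg] e.
- by move=> _; apply: PolC.
- by case: e => // e le_de; apply: PolX => //; apply: IH.
- by move=> le_de; apply: PolD; [apply: IHf | apply: IHg].
Qed.

Lemma polfun_local (C : numClosedFieldType) n d (f : (nat -> C) -> C) x y :
  polfun n d f -> (forall i, (i < n)%N -> x i = y i) -> f x = f y.
Proof.
by move=> f_pol eq_xy; elim: f_pol => // {d f} [d i f /eq_xy -> _ ->|d f g _ -> _ ->].
Qed.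

Lemma polfunX (C : numClosedFieldType) n d i :
  (i < n)%N -> (0 < d)%N -> polfun n d (fun x : nat -> C => x i).
Proof.
case: d => // d lt_in _; apply: polfun_eq (PolX lt_in (PolC C n d 1)) => x.
by rewrite mulr1.
Qed.

Lemma polfunM (C : numClosedFieldType) n d e (f g : (nat -> C) -> C) :
  polfun n d f -> polfun n e g -> polfun n (d + e) (fun x => f x * g x).
Proof.
move=> f_pol g_pol; elim: f_pol => {d f} [d m|d i f lt_in _ IH|d f h _ IHf _ IHh].
- apply: (@polfunW _ _ e); first exact: leq_addl.
  elim: g_pol => {d e g} [d k|d i g lt_in _ IH|d f g _ IHf _ IHg].
  + by apply: polfun_eq (PolC _ _ _ (m * k)) => x; rewrite intrM.
  + by apply: polfun_eq (PolX lt_in IH) => x; rewrite mulrCA.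
  + by apply: polfun_eq (PolD IHf IHg) => x; rewrite mulrDr.
- by rewrite addSn; apply: polfun_eq (PolX lt_in IH) => x; rewrite mulrA.
- by apply: polfun_eq (PolD IHf IHh) => x; rewrite mulrDl.
Qed.

Lemma polfun_sum (C : numClosedFieldType) n d I (r : seq I) (P : pred I)
    (F : I -> (nat -> C) -> C) :
  (forall i, P i -> polfun n d (F i)) ->
  polfun n d (fun x => \sum_(i <- r | P i) F i x).
Proof.
move=> F_pol; elim: r => [|i r IH].
  by apply: polfun_eq (PolC _ _ _ 0) => x; rewrite big_nil.
have [Pi|nPi] := boolP (P i).
  by apply: polfun_eq (PolD (F_pol i Pi) IH) => x; rewrite big_cons Pi.
by apply: polfun_eq IH => x; rewrite big_cons (negPf nPi).
Qed.

Lemma polfun_prod (C : numClosedFieldType) n d I (r : seq I)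
    (F : I -> (nat -> C) -> C) :
  (forall i, polfun n d (F i)) ->
  polfun n (size r * d) (fun x => \prod_(i <- r) F i x).
Proof.
move=> F_pol; elim: r => [|i r IH].
  by apply: polfun_eq (PolC _ _ _ 1) => x; rewrite big_nil.
by rewrite mulSn; apply: polfun_eq (polfunM (F_pol i) IH) => x; rewrite big_cons.
Qed.

Lemma polfun_det (C : numClosedFieldType) n d m (A : (nat -> C) -> 'M[C]_m) :
  (forall i j, polfun n d (fun x => A x i j)) ->
  polfun n (m * d) (fun x => \det (A x)).
Proof.
move=> A_pol; apply: polfun_sum => s _.
have sgn_pol : polfun n 0 (fun=> (-1) ^+ s : C).
  by apply: polfun_eq (PolC _ _ _ ((-1) ^+ s)) => x; rewrite rmorphXn /= rmorphN1.
apply: (polfunM sgn_pol).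
have := @polfun_prod C n d _ (index_enum 'I_m) (fun i x => A x i (s i)).
by rewrite -[index_enum _]enumT size_enum_ord; apply.
Qed.

(** A line in the direction [c]. Coordinates of [x] from [n] on are replaced by 0, so that the
    coefficients in [t] involve only [n] variables. *)
Definition shear (C : numClosedFieldType) n (c : nat -> nat) (x : nat -> C) t :
    nat -> C :=
  fun j => (if (j < n)%N then x j else 0) + (c j)%:R * t.

(* [h] is the homogeneous part of degree [d] of [f]: the coefficient of [t ^+ d]
   in [f (x + t c)] is the constant [h c]. *)
Lemma polfun_shear (C : numClosedFieldType) n d (f : (nat -> C) -> C) :
  polfun n.+1 d f ->
  exists h l : (nat -> C) -> C,
  [/\ forall x, f x = h x + l x, polfun n.+1 d h,
      if d is d'.+1 then polfun n.+1 d' l else forall x, l x = 0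
    & forall c : nat -> nat, exists G : (nat -> C) -> {poly C},
      [/\ forall x, (size (G x) <= d.+1)%N,
          forall i, polfun n d (fun x => (G x)`_i),
          forall x t, f (shear n c x t) = (G x).[t]
        & forall x, (G x)`_d = h (fun j => (c j)%:R)]].
Proof.
elim=> {d f} [d m|d i f lt_in _ [h [l [fE h_pol l_pol hG]]]|
  d f1 f2 _ [h1 [l1 [f1E h1_pol l1_pol hG1]]] _ [h2 [l2 [f2E h2_pol l2_pol hG2]]]].
(* As [d] is only a bound, a constant contributes to the part of degree [d] just when [d] is 0. *)
- exists (fun=> if d is 0 then m%:~R else 0), (fun=> if d is 0 then 0 else m%:~R).
  split=> //.
  + by case: d => *; rewrite ?addr0 ?add0r.
  + by case: d => [|d]; [exact: PolC | exact: (PolC C n.+1 d.+1 0)].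
  + by case: d => // d; apply: PolC.
  move=> c; exists (fun=> m%:~R%:P); split=> //.
  + by move=> x; rewrite (leq_trans (size_polyC_leq1 _)).
  + move=> i; apply: polfun_eq (PolC _ _ _ (if i == 0 then m else 0)) => x.
    by rewrite coefC; case: ifP.
  + by move=> x t; rewrite hornerC.
  + by move=> x; rewrite coefC; case: d.
- exists (fun x => x i * h x), (fun x => x i * l x); split.
  + by move=> x; rewrite fE mulrDr.
  + exact: PolX.
  + case: d l_pol {h_pol hG} => [l0|d l_pol]; last exact: PolX.
    by apply: polfun_eq (PolC _ _ _ 0) => x; rewrite l0 mulr0.
  move=> c; have [G [szG G_pol GE G_top]] := hG c.
  pose y (x : nat -> C) := if (i < n)%N then x i else 0.
  have coefG x j : (((y x)%:P + (c i)%:R *: 'X) * G x)`_j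
      = y x * (G x)`_j + (if j is j'.+1 then (c i)%:R * (G x)`_j' else 0).
    rewrite mulrDl coefD coefCM -scalerAl coefZ coefXM.
    by case: j => [|j]; rewrite /= ?mulr0.
  exists (fun x => ((y x)%:P + (c i)%:R *: 'X) * G x); split.
  + move=> x; rewrite (leq_trans (size_polyMleq _ _)) //.
    rewrite -subn1 leq_subLR -[(1 + d.+2)%N]/(2 + d.+1)%N leq_add //.
    rewrite (leq_trans (size_polyD _ _)) //.
    rewrite geq_max (leq_trans (size_polyC_leq1 _)) //=.
    by rewrite (leq_trans (size_scale_leq _ _)) // size_polyX.
  + move=> j; pose z := fun x => if j is j'.+1 then (c i)%:R * (G x)`_j' else 0.
    have z_pol : polfun n d z.
      rewrite /z; case: j {z} => [|j]; first exact: (PolC C n d 0).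
      exact: (@polfunM _ n 0 d _ _ (PolC C n 0 (c i)) (G_pol j)).
    have y_pol : polfun n d.+1 (fun x => y x * (G x)`_j).
      rewrite /y; case: (ltnP i n) => [lt_i|_]; first exact: PolX.
      by apply: polfun_eq (PolC _ _ _ 0) => x; rewrite mul0r.
    apply: polfun_eq (PolD y_pol (polfunW (leqnSn d) z_pol)) => x.
    by rewrite coefG.
  + by move=> x t; rewrite GE /shear -/(y x) hornerM !hornerE.
  + move=> x; rewrite coefG G_top nth_default ?szG // mulr0 add0r //.
- exists (fun x => h1 x + h2 x), (fun x => l1 x + l2 x); split.
  + by move=> x; rewrite f1E f2E addrACA.
  + exact: PolD.
  + case: d l1_pol l2_pol {h1_pol h2_pol hG1 hG2} => [l10 l20 x|d]; last exact: PolD.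
    by rewrite l10 l20 addr0.
  move=> c; have [G1 [szG1 G1_pol G1E G1_top]] := hG1 c.
  have [G2 [szG2 G2_pol G2E G2_top]] := hG2 c.
  exists (fun x => G1 x + G2 x); split.
  + by move=> x; rewrite (leq_trans (size_polyD _ _)) // geq_max szG1 szG2.
  + by move=> i; apply: polfun_eq (PolD (G1_pol i) (G2_pol i)) => x; rewrite coefD.
  + by move=> x t; rewrite G1E G2E hornerD.
  + by move=> x; rewrite coefD G1_top G2_top.
Qed.

(** * Nonvanishing at natural points *)

Lemma nat_nonroot (C : numFieldType) (p : {poly C}) :
  p != 0 -> exists m : nat, p.[m.+1%:R] != 0.
Proof.
move=> nz_p; apply: contrapT => no_m.
pose rs : seq C := [seq m.+1%:R | m <- iota 0 (size p)].
have := @max_poly_roots _ p rs nz_p.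
rewrite size_map size_iota ltnn => H; suff: false by []; apply: H.
  apply/allP => _ /mapP[m _ ->]; rewrite /root; apply/negPn/negP => p_neq0.
  by apply: no_m; exists m.
rewrite map_inj_uniq ?iota_uniq // => m m' /eqP.
by rewrite eqr_nat eqSS => /eqP.
Qed.

(** By induction on [n]: at natural values of the other coordinates, [h] is a univariate polynomial
    in the last one that vanishes at all positive integers. Positivity serves to get shear
    directions with [c n] invertible. *)
Lemma polfun_nat_eq0 (C : numClosedFieldType) n d (h : (nat -> C) -> C) :
  polfun n d h ->
  (forall c : nat -> nat, (forall i, (0 < c i)%N) -> h (fun i => (c i)%:R) = 0) ->
  forall x, h x = 0.
Proof.
elim: n h => [|n IHn] h h_pol h0 x.
  by rewrite (@polfun_local _ _ _ _ x (fun=> 1%:R) h_pol) // (h0 (fun=> 1%N)).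
(* Along the unit vector of index [n], the shear merely replaces coordinate [n] by [t]. *)
have [h' [l' [_ _ _ /(_ (fun j => (j == n : nat)))[G [szG G_pol GE _]]]]] :=
  polfun_shear h_pol.
have shearE (y : nat -> C) (t : C) i : (i < n.+1)%N ->
    shear n (fun j => (j == n : nat)) y t i = if i == n then t else y i.
  rewrite /shear ltnS leq_eqVlt => /predU1P[->|lt_in].
    by rewrite ltnn eqxx add0r mul1r.
  by rewrite lt_in ltn_eqF // mul0r addr0.
suff G0 : G x = 0.
  rewrite (@polfun_local _ _ _ _ _ (shear n (fun j => (j == n : nat)) x (x n)) h_pol).
    by rewrite GE G0 horner0.
  by move=> i /shearE ->; case: eqP => [->|].
apply/polyP => i; rewrite coef0; apply: (IHn _ (G_pol i)) => c c_gt0.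
suff -> : G (fun j => (c j)%:R) = 0 by rewrite coef0.
apply/eqP/contraT => /nat_nonroot[m]; rewrite -GE.
rewrite (@polfun_local _ _ _ _ _ (fun j => (if j == n then m.+1 else c j)%:R) h_pol).
  by rewrite h0 ?eqxx // => j; case: ifP.
by move=> j /shearE ->; case: eqP.
Qed.

(* Where [f] and [g] do not both vanish, [f + m g] vanishes for at most one [m]. *)
Lemma common_nonzero (C : numFieldType) (S : (C -> C) -> Prop) (rs : seq C) :
  (exists g, S g) ->
  (forall f g (m : nat), S f -> S g -> S (fun t => f t + m%:R * g t)) ->
  (forall t, t \in rs -> exists2 g, S g & g t != 0) ->
  exists2 g, S g & forall t, t \in rs -> g t != 0.
Proof.
move=> [g0 Sg0] S_closed; elim: rs => [|r rs IH] S_nz; first by exists g0.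
have [|g Sg g_nz] := IH.
  by move=> t t_rs; apply: S_nz; rewrite inE t_rs orbT.
have [h Sh h_nz] := S_nz r (mem_head _ _).
pose p t : {poly C} := (g t)%:P + h t *: 'X.
have [|m] := @nat_nonroot _ (\prod_(t <- r :: rs) p t).
  rewrite prodf_seq_neq0; apply/allP => t t_rs /=.
  apply: contraTneq t_rs => /polyP pt0; rewrite inE negb_or.
  have := pt0 0; have := pt0 1%N; rewrite !coefE /= mulr0 mulr1 add0r addr0 => ht0 gt0.
  apply/andP; split; first by apply: contraNneq h_nz => <-; rewrite ht0.
  by apply/negP => /g_nz; rewrite gt0 eqxx.
rewrite horner_prod prodf_seq_neq0 => /allP nz_m.
exists (fun t => g t + m.+1%:R * h t); first exact: S_closed.
by move=> t /nz_m /=; rewrite !hornerE mulrC.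
Qed.

(** * Resultants through Sylvester matrices *)

(* Unlike [resultant], the format depends on the degree bounds [d] and [e] only, so
   that it commutes with specialization when the leading coefficient of [q]
   vanishes. *)
Definition sylvester (C : fieldType) d e (p q : {poly C}) : 'M[C]_(d + e) :=
  col_mx (\matrix_(i < d, j < d + e) ('X^i * p)`_j)
         (\matrix_(i < e, j < d + e) ('X^i * q)`_j).

(** The matrix kills the nonzero vector of powers of [t], since its rows evaluate to [t ^+ i *
    p.[t]] and [t ^+ i * q.[t]]. *)
Lemma sylvester_common_root (C : fieldType) d e (p q : {poly C}) t :
  (0 < e)%N -> (size p <= e.+1)%N -> (size q <= d.+1)%N ->
  root p t -> root q t -> \det (sylvester d e p q) = 0.
Proof.
move=> e_gt0 szp szq pt0 qt0; apply/eqP; rewrite -det_tr; apply/det0P.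
have rowE (r : {poly C}) m i : (size r <= m.+1)%N -> (i + m < d + e)%N -> root r t ->
    \sum_(j < d + e) t ^+ j * ('X^i * r)`_j = 0.
  move=> szr lt_im /rootP rt0.
  transitivity ('X^i * r).[t]; last by rewrite hornerM rt0 mulr0.
  rewrite (@horner_coef_wide _ (d + e)).
    by apply: eq_bigr => j _; rewrite mulrC.
  rewrite (leq_trans (size_polyMleq _ _)) // size_polyXn addSn /=.
  by rewrite (leq_trans _ lt_im) // -addnS leq_add2l.
exists (\row_j t ^+ j).
  apply/eqP => /rowP/(_ (Ordinal (ltn_addl d e_gt0))).
  by rewrite !mxE expr0 => /eqP; rewrite oner_eq0.
apply/rowP => i; rewrite !mxE.
under eq_bigr => j _ do rewrite 3!mxE.
case: (splitP i) => i' _.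
  under eq_bigr => j _ do rewrite mxE.
  by apply: (rowE _ e) => //; rewrite ltn_add2r.
under eq_bigr => j _ do rewrite mxE.
by apply: (rowE _ d) => //; rewrite addnC ltn_add2l.
Qed.

(** A kernel row encodes [U * p + W * q = 0] with [W] of smaller degree than [p]. Were [p] and [q]
    coprime, [p] would divide [W], forcing [W] and then [U] to vanish. *)
Lemma common_root_sylvester (C : closedFieldType) d e (p q : {poly C}) :
  size p = e.+1 -> (size q <= d.+1)%N -> \det (sylvester d e p q) = 0 ->
  exists2 t, root p t & root q t.
Proof.
move=> szp szq /eqP/det0P[v nz_v].
rewrite -[v]hsubmxK mul_row_col; set u := lsubmx v; set w := rsubmx v.
move=> uw0; pose U := rVpoly u; pose W := rVpoly w.
have rowE m (z : 'rV[C]_m) (r : {poly C}) (j : 'I_(d + e)) :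
    (z *m (\matrix_(i < m, j < d + e) ('X^i * r)`_j)) 0 j = (rVpoly z * r)`_j.
  rewrite !mxE /rVpoly poly_def mulr_suml coef_sum; apply: eq_bigr => i _.
  by rewrite mxE valK -scalerAl coefZ.
have UW0 : U * p + W * q = 0.
  apply/polyP => j; rewrite coef0; have [lt_j|ge_j] := ltnP j (d + e).
    have /rowP/(_ (Ordinal lt_j)) := uw0.
    by rewrite mxE !rowE mxE coefD.
  apply: nth_default; apply: leq_trans ge_j.
  rewrite (leq_trans (size_polyD _ _)) // geq_max.
  have szU : (size U + size p <= d + e.+1)%N by rewrite leq_add ?szp ?size_poly.
  have szW : (size W + size q <= e + d.+1)%N by rewrite leq_add ?size_poly.
  apply/andP; split; rewrite (leq_trans (size_polyMleq _ _)) // -subn1 leq_subLR.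
    by rewrite (leq_trans szU) // addnS.
  by rewrite (leq_trans szW) // addnS addnC.
suff : ~~ coprimep p q.
  rewrite /coprimep => /closed_rootP[t]; rewrite root_gcd => /andP[pt0 qt0].
  by exists t.
apply/negP => co_pq; case/eqP: nz_v.
have W0 : W = 0.
  apply/eqP/contraT => nz_W.
  have : p %| W.
    rewrite -(Gauss_dvdpl _ co_pq) -(dvdp_addr _ (dvdp_mull U (dvdpp p))).
    by rewrite UW0 dvdp0.
  by move/(dvdp_leq nz_W); rewrite szp => /leq_trans/(_ (size_poly _ _)); rewrite ltnn.
have nz_p : p != 0 by rewrite -size_poly_eq0 szp.
have U0 : U = 0.
  by move: UW0; rewrite W0 mul0r addr0 => /eqP; rewrite mulf_eq0 (negPf nz_p) orbF => /eqP.
rewrite -[v]hsubmxK -/u -/w -[u]rVpolyK -[w]rVpolyK -/U -/W U0 W0.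
by rewrite !linear0 row_mx0.
Qed.

(** * Specialization of a point over a number field *)

Lemma polfun_image (C : numClosedFieldType) (K : fieldType)
    (iota : {rmorphism K -> C}) (b : nat -> K) n d (f : (nat -> C) -> C) :
  polfun n d f -> exists y, f (iota \o b) = iota y.
Proof.
elim=> {d f} [d m|d i f _ _ [y fy]|d f g _ [y fy] _ [z gz]].
- by exists m%:~R; rewrite rmorph_int.
- by exists (b i * y); rewrite /= fy rmorphM.
- by exists (y + z); rewrite fy gz rmorphD.
Qed.

(** The factor [d] bounds the degree of the adjoined root; [(d + d) * d] bounds the degree of a
    Sylvester determinant of order at most [d + d] with entries of degree at most [d]. *)
Fixpoint spec_degree n d : nat :=
  if n is n'.+1 then d * spec_degree n' ((d + d) * d) else 1.

Lemma spec_degree_gt0 n d : (0 < d)%N -> (0 < spec_degree n d)%N.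
Proof.
elim: n d => //= n IHn d d_gt0.
by rewrite muln_gt0 d_gt0 IHn // muln_gt0 addn_gt0 d_gt0.
Qed.

(** The extra factor [d + d] carries the induction: the next degree [e] satisfies
    [e + e = (d + d) ^ 2], so each step squares the base. *)
Lemma spec_degree_le n d :
  (0 < d)%N -> ((d + d) * spec_degree n d <= (d + d) ^ (2 ^ n))%N.
Proof.
elim: n d => [|n IHn] d d_gt0; first by rewrite muln1 expn0 expn1.
set e := ((d + d) * d)%N.
have e_gt0 : (0 < e)%N by rewrite muln_gt0 d_gt0 addn_gt0 d_gt0.
have := IHn e e_gt0.
have -> : (e + e = (d + d) ^ 2)%N by rewrite /e -mulnDr mulnn.
rewrite -expnM -expnS; apply: leq_trans => /=.
by rewrite mulnA leq_mul2r -mulnn mulnDr leq_addr orbT.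
Qed.

Lemma specialization (C : numClosedFieldType) n d (a : nat -> C) :
  (0 < d)%N ->
  exists (K : fieldExtType rat) (iota : {rmorphism K -> C}) (b : nat -> K),
    (\dim {:K} <= spec_degree n d)%N /\
    (forall f, polfun n d f -> f a = 0 -> f (iota \o b) = 0).
Proof.
elim: n d a => [|n IHn] d a d_gt0.
  exists rat^o, ratr, (fun=> 0); split; first by rewrite dimvf.
  by move=> f f_pol <-; apply: polfun_local f_pol _.
pose P e := `[< exists f, [/\ polfun n.+1 e f, f a = 0 & exists x, f x != 0] >].
(* If no such [e] is at most [d], only the zero function of degree at most [d] vanishes at [a], and
   a rational point suffices. *)
have [[e0 [Pe0 le_e0d]]|noP] := pselect (exists e, P e /\ (e <= d)%N); last first.
  exists rat^o, ratr, (fun=> 0); split.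
    by rewrite dimvf spec_degree_gt0.
  move=> f f_pol fa0; apply/eqP/contraT => f_neq0; case: noP; exists d; split=> //.
  by apply/asboolP; exists f; split=> //; eexists; apply: f_neq0.
have exP : exists e, P e by exists e0.
case: (ex_minnP exP) => e /asboolP[f [f_pol fa0 [x0 fx0]]] e_min.
have le_ed : (e <= d)%N := leq_trans (e_min _ Pe0) le_e0d.
have [h [l [fE h_pol l_pol /[dup] hG]]] := polfun_shear f_pol.
(* If [h] vanished identically, [f] would equal [l], which is zero or of degree below [e], against
   the choice of [f]. *)
have [c [c_gt0 hc]] : exists c : nat -> nat, (forall i, (0 < c i)%N) /\
    h (fun i => (c i)%:R) != 0.
  apply: contrapT => no_c.
  have h0 x : h x = 0.
    apply: (polfun_nat_eq0 h_pol) => c c_gt0; apply/eqP/contraT => hc.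
    by case: no_c; exists c.
  have fl x : l x = f x by rewrite fE h0 add0r.
  case: e f_pol e_min le_ed h_pol l_pol {hG} => [|e] _ e_min _ _ l_pol.
    by rewrite -fl l_pol eqxx in fx0.
  suff : P e by move/e_min; rewrite ltnn.
  apply/asboolP; exists f; split=> //; last by exists x0.
  exact: polfun_eq fl l_pol.
move/(_ c) => [G [szG G_pol GE G_top]] {hG}.
(* The leading coefficient is the nonzero constant [h c], so the degree in [t] is exactly [e] over
   every base point. *)
have szGE x : size (G x) = e.+1.
  apply/eqP; rewrite eqn_leq szG; apply: contraNT hc; rewrite -leqNgt => szG_le.
  by rewrite -(G_top x) nth_default.
(* Chosen so that [a] is the point of parameter [t0] on the line given by [a']. *)
pose t0 := a n / (c n)%:R; pose a' i := a i - (c i)%:R * t0.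
have shear_a g k : polfun n.+1 k g -> g (shear n c a' t0) = g a.
  move=> g_pol; apply: polfun_local g_pol _ => i; rewrite /shear ltnS leq_eqVlt.
  case/predU1P=> [->|lt_in]; last by rewrite lt_in subrK.
  by rewrite ltnn add0r mulrCA divff ?mulr1 // pnatr_eq0 -lt0n.
have e_gt0 : (0 < e)%N.
  rewrite lt0n; apply: contraNneq hc => eq_e0.
  move: fa0; rewrite -(shear_a _ _ f_pol) GE -(G_top a') eq_e0.
  have /size1_polyC -> : (size (G a') <= 1)%N by rewrite szGE eq_e0.
  by rewrite hornerC coefC eqxx => ->.
have D_gt0 : (0 < (d + d) * d)%N by rewrite muln_gt0 addn_gt0 d_gt0.
have [K [iota [b [dimK b_spec]]]] := IHn _ a' D_gt0.
pose b' := iota \o b.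
(* One root must serve all [g] at once. Otherwise [common_nonzero] yields a single [g] that is
   nonzero at every root, while its resultant with [f] vanishes at [a'], hence at [b'], which gives
   a common root. *)
have [t ft t_spec] : exists2 t, root (G b') t &
    forall g, polfun n.+1 d g -> g a = 0 -> g (shear n c b' t) = 0.
  apply: contrapT => no_t.
  have [rs GE_rs] := closed_field_poly_normal (G b').
  have nzG : G b' != 0 by rewrite -size_poly_eq0 szGE.
  have mem_rs t : (t \in rs) = root (G b') t.
    by rewrite GE_rs rootZ ?lead_coef_eq0 // root_prod_XsubC.
  pose S (s : C -> C) := exists g, [/\ polfun n.+1 d g, g a = 0 &
                                       s = fun t => g (shear n c b' t)].
  have [||t|s [g [g_pol ga0 ->]] s_nz] := @common_nonzero _ S rs.
  - by exists (fun=> 0), (fun=> 0); split=> //; apply: (PolC C n.+1 d 0).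
  - move=> _ _ m [g1 [g1_pol g1a ->]] [g2 [g2_pol g2a ->]].
    exists (fun x => g1 x + m%:R * g2 x); split=> //.
      by apply: PolD => //; apply: (@polfunM _ _ 0 d _ _ (PolC C n.+1 0 m)).
    by rewrite g1a g2a mulr0 addr0.
  - rewrite mem_rs => Gt0; apply: contrapT => no_g; apply: no_t.
    exists t => // g g_pol ga0.
    apply/eqP/contraT => gt_nz; case: no_g.
    by exists (fun t => g (shear n c b' t)) => //; exists g.
  have [h' [l' [_ _ _ /(_ c)[H [szH H_pol HE _]]]]] := polfun_shear g_pol.
  have det_pol : polfun n ((d + d) * d) (fun x => \det (sylvester d e (G x) (H x))).
    apply: (@polfunW _ _ ((d + e) * d)); first by rewrite leq_mul2r leq_add2l le_ed orbT.
    have coef_pol (F : (nat -> C) -> {poly C}) i j :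
        (forall i, polfun n d (fun x => (F x)`_i)) ->
        polfun n d (fun x => ('X^i * F x)`_j).
      move=> F_pol; apply: polfun_eq (_ : polfun n d (fun x =>
          if (j < i)%N then 0 else (F x)`_(j - i))).
        by move=> x; rewrite coefXnM.
      by case: (j < i)%N; [apply: (PolC C n d 0) | apply: F_pol].
    apply: polfun_det => i j; rewrite /sylvester.
    case: (split_ordP i) => i' ->.
      apply: polfun_eq (coef_pol G i' j _) => [x|k]; first by rewrite col_mxEu mxE.
      exact: polfunW (G_pol k).
    apply: polfun_eq (coef_pol H i' j _) => [x|k]; first by rewrite col_mxEd mxE.
    exact: H_pol.
  have [|t Gt Ht] := common_root_sylvester (szGE b') (szH b').
    apply: (b_spec _ det_pol).
    apply: (@sylvester_common_root _ _ _ _ _ t0); rewrite ?szGE //.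
      by rewrite /root -GE (shear_a _ _ f_pol) fa0.
    by rewrite /root -HE (shear_a _ _ g_pol) ga0.
  have := s_nz t; rewrite mem_rs HE (eqP Ht) eqxx => /(_ Gt); discriminate.
(* The coefficients of [G] are integer polynomials, so their values at [b'] come from [K]. *)
have [p pE] : exists p, map_poly iota p = G b'.
  have /choice[y yE] : forall i, exists y, (G b')`_i = iota y.
    by move=> i; apply: polfun_image (G_pol i).
  exists (\poly_(i < e.+1) y i); apply/polyP => i; rewrite coef_map coef_poly /=.
  case: ltnP => [_|ge_i]; first by rewrite yE.
  by rewrite rmorph0 nth_default // szGE.
have nz_p : p != 0 by rewrite -(map_poly_eq0 iota) pE -size_poly_eq0 szGE.
have pt0 : root (map_poly iota p) t by rewrite pE.
have [E [iotaE [j [w [jE wE dimE]]]]] := adjoin_root nz_p pt0.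
exists E, iotaE, (fun i => (if (i < n)%N then j (b i) else 0) + (c i)%:R * w).
split.
  rewrite (leq_trans dimE) //= leq_mul // -(size_map_poly iota) pE szGE //.
move=> g g_pol ga0; rewrite -(t_spec g g_pol ga0); congr g; apply/funext => i.
rewrite /shear /= rmorphD rmorphM rmorph_nat wE; congr (_ + _).
by case: ifP; rewrite ?rmorph0.
Qed.

(** * Term counts and [Qmin] under field extension *)

Lemma nterms_iota (K : fieldType) (f : {poly K}) m :
  (size f <= m)%N -> nterms f = count (fun i => f`_i != 0) (iota 0 m).
Proof.
move=> szf; rewrite -(subnKC szf) iotaD count_cat add0n.
rewrite [X in (_ + X)%N](@eq_in_count _ _ pred0) ?count_pred0 ?addn0; last first.
  by move=> i; rewrite mem_iota => /andP[ge_i _]; rewrite nth_default ?eqxx.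
rewrite /nterms -[in LHS](mkseq_nth 0 f) /mkseq count_map.
exact: eq_count.
Qed.

Lemma nterms_map_poly (K L : fieldType) (iota : {rmorphism K -> L})
    (f : {poly K}) :
  nterms (map_poly iota f) = nterms f.
Proof.
rewrite !(@nterms_iota _ _ (size f)) ?size_map_poly //.
by apply: eq_count => i; rewrite coef_map fmorph_eq0.
Qed.

Lemma Qmin_attained (K : fieldType) k :
  exists2 f : {poly K}, nterms f = k & nterms (f ^+ 2) = Qmin K k.
Proof.
by rewrite /Qmin; case: ex_minnP => m /asboolP[f [fk <-]] _; exists f.
Qed.

Lemma Qmin_le (K : fieldType) (f : {poly K}) :
  (Qmin K (nterms f) <= nterms (f ^+ 2))%N.
Proof.
by rewrite /Qmin; case: ex_minnP => m _; apply; apply/asboolP; exists f.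
Qed.

Lemma Qmin_extension (K L : fieldType) (iota : {rmorphism K -> L}) k :
  (Qmin L k <= Qmin K k)%N.
Proof.
have [f <- <-] := Qmin_attained K k.
by rewrite -(nterms_map_poly iota f) -(nterms_map_poly iota) rmorphXn Qmin_le.
Qed.

(* Coefficient of ['X^i] in the polynomial with support [m :: M :: u], both
   coefficients at [m] and [M] being 1 and the others being read off [x]. *)
Definition sparse_coef (R : nzRingType) (m M : nat) (u : seq nat)
    (x : nat -> R) i : R :=
  if (i == m) || (i == M) then 1 else if i \in u then x (index i u) else 0.

Lemma polfun_sparse_coef (C : numClosedFieldType) m M u i n :
  (size u <= n)%N -> polfun n 1 (fun x : nat -> C => sparse_coef m M u x i).
Proof.
move=> szu; rewrite /sparse_coef; case: orb; first exact: (PolC C n 1 1).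
have [iu|_] := boolP (i \in u); last exact: (PolC C n 1 0).
by apply: polfunX => //; rewrite (leq_trans _ szu) ?index_mem.
Qed.

(* Rescaling [f] to [c f(t X)] makes two prescribed coefficients equal to 1. *)
Lemma rescale_coefs (C : closedFieldType) (f : {poly C}) (m M : nat) :
  (m < M)%N -> f`_m != 0 -> f`_M != 0 ->
  exists c t, [/\ c != 0, t != 0, c * t ^+ m * f`_m = 1 & c * t ^+ M * f`_M = 1].
Proof.
move=> lt_mM nz_m nz_M.
have /closed_rootP[t] : size ('X^(M - m) - (f`_m / f`_M)%:P : {poly C}) != 1%N.
  by rewrite size_XnsubC ?subn_gt0 // eqSS -lt0n subn_gt0.
rewrite /root !hornerE subr_eq0 => /eqP tE.
have nz_t : t != 0.
  apply: contraNneq (mulf_neq0 nz_m (invr_neq0 nz_M)) => t0.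
  by rewrite -tE t0 expr0n subn_eq0 leqNgt lt_mM.
exists (t ^+ m * f`_m)^-1, t.
have nz_tf : t ^+ m * f`_m != 0 by rewrite mulf_neq0 ?expf_neq0.
split=> //; first by rewrite invr_eq0.
  by rewrite -mulrA mulVf.
have tM : t ^+ M * f`_M = t ^+ m * f`_m.
  by rewrite -{1}(subnKC (ltnW lt_mM)) exprD tE -mulrA divfK.
by rewrite -mulrA tM mulVf.
Qed.

(** * Descent of an optimal polynomial to a number field *)

Lemma Qmin_number_field (C : numClosedFieldType) q :
  (0 < q)%N ->
  exists K : fieldExtType rat, Qmin C q.+2 = Qmin K q.+2 /\
    (\dim {:K} <= spec_degree q.+1 q.+1)%N.
Proof.
move=> q_gt0; have [f fk f2k] := Qmin_attained C q.+2.
pose s := [seq i <- iota 0 (size f) | f`_i != 0].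
have szs : size s = q.+2 by rewrite size_filter -nterms_iota.
have mem_s i : (i \in s) = (f`_i != 0).
  rewrite mem_filter mem_iota /= add0n; have [//|ge_i] := ltnP i (size f).
    by rewrite andbT.
  by rewrite nth_default ?eqxx.
have s_sorted : sorted ltn s.
  by rewrite sorted_filter ?iota_ltn_sorted //; apply: ltn_trans.
have s_uniq : uniq s by rewrite filter_uniq ?iota_uniq.
(* [m < M] are the two lowest exponents of the support, [u] lists the [q] others. *)
case: s szs mem_s s_sorted s_uniq => [|m [|M u]] //= [szu] mem_s /andP[lt_mM _] s_uniq.
have [u_uniq m_notin M_notin] : [/\ uniq u, m \notin u & M \notin u].
  by move: s_uniq; rewrite inE negb_or => /and3P[/andP[_ ->] -> ->].
have nz_m : f`_m != 0 by rewrite -mem_s mem_head.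
have nz_M : f`_M != 0 by rewrite -mem_s !inE eqxx orbT.
have [c [t [nz_c nz_t cm cM]]] := rescale_coefs lt_mM nz_m nz_M.
pose g i := c * t ^+ i * f`_i.
have g_eq0 i : (g i == 0) = (i \notin m :: M :: u).
  by rewrite mem_s negbK !mulf_eq0 (negPf nz_c) expf_eq0 (negPf nz_t) andbF.
pose y := \prod_(j < q) g (nth 0%N u j).
have nz_y : y != 0.
  apply/prodf_neq0 => j _; rewrite g_eq0 negbK !inE mem_nth ?szu //.
  by rewrite !orbT.
pose a j := if (j < q)%N then g (nth 0%N u j) else y^-1.
have coef_a i : sparse_coef m M u a i = g i.
  rewrite /sparse_coef; case: eqP => [->|/eqP nim] /=; first by rewrite -cm.
  case: eqP => [->|/eqP niM]; first by rewrite -cM.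
  case: ifP => [iu|/negbT niu]; first by rewrite /a -szu index_mem iu nth_index.
  by apply/esym/eqP; rewrite g_eq0 !inE !negb_or nim niM.
have [K [iota [b [dimK b_spec]]]] := specialization q.+1 a (ltn0Sn q).
exists K; split=> //; apply/eqP; rewrite eqn_leq (Qmin_extension iota) /= -f2k.
have coef_b i : iota (sparse_coef m M u b i) = sparse_coef m M u (iota \o b) i.
  by rewrite /sparse_coef; do 2?case: ifP => _; rewrite ?rmorph1 ?rmorph0.
have nz_b j : (j < q)%N -> b j != 0.
  move=> lt_jq; rewrite -(fmorph_eq0 iota).
  (* This polynomial vanishes at [a], hence at [b], where it forces nonzero coordinates. Its degree
     [q.+1] dictates the degree used in [specialization]. *)
  have prod_pol : polfun q.+1 q.+1 (fun x : nat -> C =>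
      x q * \prod_(j < q) x j + (-1)%:~R).
    apply: PolD; last exact: PolC.
    apply: PolX => //; have := @polfun_prod C q.+1 1 _ (index_enum 'I_q) (fun j x => x j).
    rewrite -[index_enum _]enumT size_enum_ord muln1; apply=> i.
    by apply: polfunX; rewrite // ltnW ?ltnS.
  have : \prod_(j < q) (iota \o b) j != 0.
    apply: contra_eq_neq (b_spec _ prod_pol _) => /= [-> | ].
      by rewrite mulr0 add0r rmorphN1 oppr_eq0 oner_eq0.
    rewrite {1}/a ltnn (eq_bigr (fun j : 'I_q => g (nth 0%N u j))); last first.
      by move=> i _; rewrite /a ltn_ord.
    by rewrite mulVf // rmorphN1 subrr.
  by move/prodf_neq0/(_ (Ordinal lt_jq) isT).
pose F := \poly_(i < size f) sparse_coef m M u b i.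
have coef_eq0 i : (sparse_coef m M u b i == 0) = (f`_i == 0).
  apply/negb_inj; rewrite -mem_s !inE /sparse_coef; case: (i == m) => /=.
    by rewrite oner_eq0.
  case: (i == M) => /=; first by rewrite oner_eq0.
  by case: ifP => [iu|_]; rewrite ?eqxx // nz_b // -szu index_mem.
have FE i : F`_i = sparse_coef m M u b i.
  rewrite coef_poly; case: ltnP => // ge_i; apply/esym/eqP.
  by rewrite coef_eq0 nth_default.
have <- : nterms F = q.+2.
  rewrite -fk !(@nterms_iota _ _ (size f)) ?size_poly //.
  by apply: eq_count => i; rewrite FE coef_eq0.
apply: leq_trans (Qmin_le F) _.
pose N := maxn (size (F ^+ 2)) (size (f ^+ 2)).
rewrite !(@nterms_iota _ _ N) ?leq_maxl ?leq_maxr //.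
(* Each coefficient absent from [f ^+ 2] must be absent from [F ^+ 2]. It is a quadric in the
   coordinates, and [2 <= q.+1] because [q] is positive. *)
apply: sub_count => i; apply: contraNN => /eqP f2i.
have sqr_pol : polfun q.+1 q.+1 (fun x : nat -> C =>
    \sum_(j < i.+1) sparse_coef m M u x j * sparse_coef m M u x (i - j)%N).
  apply: (@polfunW _ _ 2) => //; apply: polfun_sum => j _.
  by apply: (@polfunM _ _ 1 1); apply: polfun_sparse_coef; rewrite szu.
have := b_spec _ sqr_pol; rewrite -(fmorph_eq0 iota) expr2 coefM rmorph_sum /= => H.
apply/eqP; rewrite -[RHS]H; first by apply: eq_bigr => j _; rewrite !FE rmorphM !coef_b.
(* Rescaling multiplies coefficient [i] of the square by [c ^+ 2 * t ^+ i], so a zero coefficient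
   stays zero. *)
transitivity (c ^+ 2 * t ^+ i * (f ^+ 2)`_i); last by rewrite f2i mulr0.
rewrite expr2 coefM mulr_sumr; apply: eq_bigr => j _.
have -> : t ^+ i = t ^+ j * t ^+ (i - j) by rewrite -exprD subnKC // -ltnS.
by rewrite !coef_a /g mulrACA [c * _ * _]mulrACA.
Qed.

Theorem theorem5p1 (R : realType) (k : nat) (hk : (3 <= k)%N) :
  exists K : fieldExtType rat,
    Qmin R[i] k = Qmin K k /\
    (\dim {:K} <= if odd k then k.+1 ^ (2 ^ k) else k ^ (2 ^ k))%N.
Proof.
case: k hk => [|[|q]] // q_gt0.
have [K [QK dimK]] := Qmin_number_field R[i] q_gt0.
exists K; split=> //; apply: (@leq_trans (q.+2 ^ (2 ^ q.+2))); last first.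
  by case: ifP => // _; rewrite leq_exp2r ?expn_gt0.
apply: leq_trans dimK _.
apply: leq_trans (leq_pmull _ (_ : 0 < q.+1 + q.+1)%N) _ => //.
apply: leq_trans (spec_degree_le _ _) _ => //.
(* Halving the outer exponent squares the base, and [2 * q.+1 <= q.+2 ^ 2]. *)
rewrite [(2 ^ q.+2)%N]expnS expnM leq_exp2r ?expn_gt0 //.
by rewrite addnn -mul2n -mulnn leq_mul.
Qed.
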